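(* Let $a$ be a complex number not equal to a non-zero integer. Then $$\sum_{k=1}^{\infty}\frac{1}{k(k^2-a^2)}=\frac{1}{4}\sum_{n=0}^{\infty}\frac{(1+a)_n^2\,(1-a)_n^2\,\left((n+1)^2(30n+19)-a^2(12n+7)\right)}{(1+a)_{2n+2}\,(1-a)_{2n+2}\,(n+1)(2n+1)}.$$
   Context: For a complex number $\lambda$ and a non-negative integer $\nu$, $(\lambda)_\nu$ denotes the Pochhammer symbol (shifted factorial): $(\lambda)_0=1$ and $(\lambda)_\nu=\lambda(\lambda+1)\cdots(\lambda+\nu-1)$ for $\nu\ge 1$. The notation $(\lambda)_\nu^2$ means $\left((\lambda)_\nu\right)^2$. *)

(* Defs.v *)
From Stdlib Require Import Reals ZArith.
From Coquelicot Require Import Coquelicot.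

Open Scope C_scope.

Fixpoint pochhammer (l : C) (n : nat) : C :=
  match n with
  | O => 1
  | S m => pochhammer l m * (l + INR m)
  end.

(* Main.v *)
(** Put [P n = (1+a)_n (1-a)_n], [H n k = P n * P k / P (n+k+1)] and
    [F n k = H n k * (n+2k+2) / ((k+1)(n+k+1))]. Then [F] and its transpose
    form a Wilf-Zeilberger pair:
    [F (n+1) k - F n k = F (k+1) n - F k n].
    Hence sums of the closed discrete one-form with components [F n k] and
    [F k n] do not depend on the path. Going from [(0,0)] to [(N,N)] along the
    two sides of the square gives partial sums of [2/(k(k^2-a^2))] plus a
    boundary sum of size [O(1/N)]; going along the staircase next to the
    diagonal gives partial sums of half the right-hand series. *)

Require Import Defs.
From Stdlib Require Import Reals ZArith Lra Lia.
From Coquelicot Require Import Coquelicot.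
Open Scope C_scope.

(** * Paired Pochhammer products and their non-vanishing *)

Definition not_nonzero_integer (a : C) : Prop :=
  forall z : Z, z <> 0%Z -> a <> RtoC (IZR z).

Definition poch_pair (a : C) (n : nat) : C :=
  pochhammer (1 + a) n * pochhammer (1 - a) n.

Definition wz (a : C) (n k : nat) : C :=
  poch_pair a n * poch_pair a k / poch_pair a (S (n + k)) *
  ((INR n + 2 * INR k + 2) / ((INR k + 1) * (INR n + INR k + 1))).

Lemma RtoC_INR_S (n : nat) : RtoC (INR (S n)) = INR n + 1.
Proof. now rewrite S_INR, RtoC_plus. Qed.

Lemma RtoC_INR_add (n m : nat) : RtoC (INR (n + m)) = INR n + INR m.
Proof. now rewrite plus_INR, RtoC_plus. Qed.

(** Pairing [1 + a + n] with [1 - a + n] makes [poch_pair a n] the product of [j^2 - a^2] for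
    [1 <= j <= n]. *)
Lemma poch_pair_S (a : C) (n : nat) :
  poch_pair a (S n) = poch_pair a n * ((INR n + 1) ^ 2 - a ^ 2).
Proof. unfold poch_pair; simpl pochhammer; ring. Qed.

(** A zero of either linear factor would make [a] the non-zero integer [n + 1] or [-(n + 1)]. *)
Lemma square_sub_neq0 (a : C) (ha : not_nonzero_integer a) (n : nat) :
  (INR n + 1) ^ 2 - a ^ 2 <> 0.
Proof.
replace ((INR n + 1) ^ 2 - a ^ 2) with ((INR (S n) - a) * (INR (S n) + a))
  by (rewrite RtoC_INR_S; ring).
apply Cmult_neq_0; intros H.
- apply (ha (Z.of_nat (S n))); [lia|].
  rewrite <- INR_IZR_INZ.
  replace a with (INR (S n) - (INR (S n) - a)) by ring.
  rewrite H; ring.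
- apply (ha (- Z.of_nat (S n))%Z); [lia|].
  rewrite opp_IZR, <- INR_IZR_INZ, RtoC_opp.
  replace a with ((INR (S n) + a) - INR (S n)) by ring.
  rewrite H; ring.
Qed.

Lemma poch_pair_neq0 (a : C) (ha : not_nonzero_integer a) (n : nat) :
  poch_pair a n <> 0.
Proof.
induction n as [|n IH].
- unfold poch_pair; simpl; rewrite Cmult_1_l.
  intros H; apply RtoC_inj in H; lra.
- rewrite poch_pair_S; apply Cmult_neq_0; [exact IH|].
  now apply square_sub_neq0.
Qed.

Lemma RtoC_neq0 (x : R) : x <> 0%R -> RtoC x <> 0.
Proof. intros hx H; apply hx, RtoC_inj, H. Qed.

Ltac real_neq0 :=
  rewrite <- ?RtoC_mult, <- ?RtoC_plus; apply RtoC_neq0; lra.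

(** * The closed one-form and its path sums *)

(** All four terms are rational multiples of [P n * P k / P (n+k+2)], so only an identity of
    rational functions in [n], [k], [a] remains. *)
Lemma wz_pair (a : C) (ha : not_nonzero_integer a) (n k : nat) :
  wz a (S n) k - wz a n k = wz a (S k) n - wz a k n.
Proof.
unfold wz.
replace (S n + k)%nat with (S (n + k)) by lia.
replace (S k + n)%nat with (S (n + k)) by lia.
replace (k + n)%nat with (n + k)%nat by lia.
rewrite (poch_pair_S a n), (poch_pair_S a k), (poch_pair_S a (S (n + k))).
pose proof (square_sub_neq0 a ha (S (n + k))) as h.
pose proof (poch_pair_neq0 a ha (S (n + k))) as hP.
revert h; rewrite !RtoC_INR_S, RtoC_INR_add; intros h.
pose proof (pos_INR n); pose proof (pos_INR k).
field_simplify_eq; [ring|].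
repeat split; try assumption; real_neq0.
Qed.

Lemma wz_sum (a : C) (ha : not_nonzero_integer a) (N : nat) :
  sum_n (wz a 0) N + sum_n (wz a (S N)) N =
  sum_n (fun n => wz a n n + wz a (S n) n) N.
Proof.
(* Closedness summed over a strip of width one: the transposed terms telescope. With [k = S N], the
   term [wz a 0 k] cancels the one by which the first side grows. *)
assert (tele : forall M k, sum_n (wz a (S k)) M - sum_n (wz a k) M =
  wz a (S M) k - wz a 0 k).
{ intros M k; induction M as [|M IH].
  - rewrite !sum_O; symmetry; now apply wz_pair.
  - rewrite !sum_Sn; change plus with Cplus.
    pose proof (wz_pair a ha (S M) k) as E.
    replace (sum_n (wz a (S k)) M + wz a (S k) (S M)
             - (sum_n (wz a k) M + wz a k (S M)))
      with ((sum_n (wz a (S k)) M - sum_n (wz a k) M)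
            + (wz a (S k) (S M) - wz a k (S M))) by ring.
    rewrite IH, <- E; ring. }
induction N as [|N IH].
- rewrite !sum_O; reflexivity.
- rewrite !sum_Sn; change plus with Cplus.
  rewrite <- IH.
  pose proof (tele N (S N)) as E.
  replace (sum_n (wz a (S (S N))) N) with
    (sum_n (wz a (S (S N))) N - sum_n (wz a (S N)) N + sum_n (wz a (S N)) N)
    by ring.
  rewrite E; ring.
Qed.

(** * Decay of the boundary sum *)

Lemma Cmod_square_sub_ge (a : C) (m : R) :
  (2 * Cmod a <= m -> m ^ 2 / 2 <= Cmod (RtoC m ^ 2 - a ^ 2))%R.
Proof.
intros hm; pose proof (Cmod_ge_0 a).
assert (E : (Cmod (RtoC m ^ 2) <= Cmod (RtoC m ^ 2 - a ^ 2) + Cmod (a ^ 2))%R).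
{ replace (RtoC m ^ 2) with ((RtoC m ^ 2 - a ^ 2) + a ^ 2) at 1 by ring.
  apply Cmod_triangle. }
rewrite !Cmod_pow, Cmod_R, pow2_abs in E; nra.
Qed.

(** The left side is at most [j^2 + |a|^2], the right side at least [j^2 + m^2 - |a|^2], and
    [m^2 >= 4 |a|^2]. *)
Lemma Cmod_square_sub_le (a : C) (j m : R) :
  (0 <= j -> 2 * Cmod a <= m ->
   Cmod (RtoC j ^ 2 - a ^ 2) <= Cmod (RtoC (m + j) ^ 2 - a ^ 2))%R.
Proof.
intros hj hm; pose proof (Cmod_ge_0 a).
assert (E : (Cmod (RtoC (m + j) ^ 2) <=
  Cmod (RtoC (m + j) ^ 2 - a ^ 2) + Cmod (a ^ 2))%R).
{ replace (RtoC (m + j) ^ 2) with ((RtoC (m + j) ^ 2 - a ^ 2) + a ^ 2) at 1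
    by ring.
  apply Cmod_triangle. }
assert (E2 : (Cmod (RtoC j ^ 2 - a ^ 2) <= Cmod (RtoC j ^ 2) + Cmod (a ^ 2))%R).
{ rewrite <- (Cmod_opp (a ^ 2)); apply Cmod_triangle. }
rewrite !Cmod_pow, Cmod_R, pow2_abs in E, E2; nra.
Qed.

(** The quotient is the product of [(j^2 - a^2) / ((k+j)^2 - a^2)] for [1 <= j <= n], each factor of
    modulus at most 1. *)
Lemma Cmod_poch_ratio_le1 (a : C) (ha : not_nonzero_integer a) (k n : nat) :
  (2 * Cmod a <= INR k)%R ->
  (Cmod (poch_pair a k * poch_pair a n / poch_pair a (k + n)) <= 1)%R.
Proof.
intros hk; induction n as [|n IH].
- replace (k + 0)%nat with k by lia.
  replace (poch_pair a k * poch_pair a 0 / poch_pair a k) with (RtoC 1).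
  + rewrite Cmod_1; lra.
  + unfold poch_pair at 2; simpl pochhammer; field; now apply poch_pair_neq0.
- replace (k + S n)%nat with (S (k + n)) by lia.
  pose proof (square_sub_neq0 a ha (k + n)) as h.
  rewrite !poch_pair_S.
  replace (poch_pair a k * (poch_pair a n * ((INR n + 1) ^ 2 - a ^ 2)) /
    (poch_pair a (k + n) * ((INR (k + n) + 1) ^ 2 - a ^ 2))) with
    (poch_pair a k * poch_pair a n / poch_pair a (k + n) *
     (((INR n + 1) ^ 2 - a ^ 2) / ((INR (k + n) + 1) ^ 2 - a ^ 2)))
    by (field; split; [exact h | now apply poch_pair_neq0]).
  rewrite Cmod_mult, (Cmod_div _ _ h).
  assert (E : (Cmod ((INR n + 1) ^ 2 - a ^ 2) <=
    Cmod ((INR (k + n) + 1) ^ 2 - a ^ 2))%R).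
  { pose proof (Cmod_square_sub_le a (INR n + 1) (INR k)) as E.
    rewrite RtoC_INR_add.
    replace (INR k + INR n + 1) with (RtoC (INR k + (INR n + 1)))
      by (rewrite !RtoC_plus; ring).
    rewrite <- (RtoC_plus (INR n) 1).
    apply E; [pose proof (pos_INR n); lra | exact hk]. }
  apply Cmod_gt_0 in h.
  apply Rle_trans with (1 * 1)%R; [|lra]; apply Rmult_le_compat.
  + apply Cmod_ge_0.
  + apply Rdiv_le_0_compat; [apply Cmod_ge_0 | exact h].
  + exact IH.
  + now apply Rle_div_l; [|rewrite Rmult_1_l].
Qed.

(** The bound is uniform in [n]: the last factor of [P (k+n+1)] has modulus at least [k^2 / 2], and
    the rational factor is at most 2. *)
Lemma Cmod_wz_le (a : C) (ha : not_nonzero_integer a) (k n : nat) :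
  (0 < k)%nat -> (2 * Cmod a <= INR k)%R ->
  (Cmod (wz a k n) <= 4 / INR k ^ 2)%R.
Proof.
intros k0 hk; apply lt_0_INR in k0; pose proof (pos_INR n).
pose proof (square_sub_neq0 a ha (k + n)) as h.
unfold wz; rewrite poch_pair_S.
set (q := ((INR k + 2 * INR n + 2) / ((INR n + 1) * (INR k + INR n + 1)))%R).
replace (poch_pair a k * poch_pair a n /
    (poch_pair a (k + n) * ((INR (k + n) + 1) ^ 2 - a ^ 2)) *
   ((INR k + 2 * INR n + 2) / ((INR n + 1) * (INR k + INR n + 1)))) with
  (poch_pair a k * poch_pair a n / poch_pair a (k + n) *
   (RtoC q / ((INR (k + n) + 1) ^ 2 - a ^ 2))).
2:{ unfold q.
    rewrite RtoC_div, !RtoC_mult, !RtoC_plus, RtoC_mult by nra.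
    field.
    repeat split; try assumption; try (now apply poch_pair_neq0);
    real_neq0. }
rewrite Cmod_mult, (Cmod_div _ _ h), Cmod_R.
(* In partial fractions, [q = 1/(n+1) + 1/(k+n+1)]. *)
assert (hq : (0 <= q <= 2)%R).
{ split.
  - apply Rdiv_le_0_compat; nra.
  - unfold q; apply Rle_div_l; nra. }
rewrite Rabs_pos_eq by apply hq.
assert (hd : (INR k ^ 2 / 2 <= Cmod ((INR (k + n) + 1) ^ 2 - a ^ 2))%R).
{ rewrite <- RtoC_plus.
  eapply Rle_trans; [|apply Cmod_square_sub_ge]; rewrite plus_INR; nra. }
assert (hd0 : (0 < INR k ^ 2 / 2)%R) by nra.
rewrite <- (Rmult_1_l (4 / _)); apply Rmult_le_compat.
- apply Cmod_ge_0.
- apply Rdiv_le_0_compat; lra.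
- now apply Cmod_poch_ratio_le1.
- apply Rle_div_l; [lra|].
  apply Rle_trans with (4 / INR k ^ 2 * (INR k ^ 2 / 2))%R.
  + replace (4 / INR k ^ 2 * (INR k ^ 2 / 2))%R with 2%R by (field; lra); lra.
  + apply Rmult_le_compat_l; [|exact hd].
    apply Rlt_le, Rdiv_lt_0_compat; nra.
Qed.

Lemma nat_upper_bound (x : R) : exists K : nat, (0 < K)%nat /\ (x <= INR K)%R.
Proof.
destruct (INR_unbounded x) as [K hK].
exists (S K); split; [lia|]; rewrite S_INR; lra.
Qed.

(** Once [N] is large against [|a|], each of the [N + 1] terms is at most [4 / (N+1)^2], so the sum
    is at most [4 / (N+1)]. *)
Lemma wz_boundary_to_0 (a : C) (ha : not_nonzero_integer a) :
  filterlim (fun N => sum_n (wz a (S N)) N) eventually (locally (RtoC 0)).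
Proof.
apply (filterlim_norm_zero (V := C_NormedModule)).
change (is_lim_seq
  (fun N => norm (V := C_NormedModule) (sum_n (wz a (S N)) N)) 0).
apply (is_lim_seq_le_le_loc (fun _ => 0%R) _ (fun N => 4 * / INR (S N))%R).
- destruct (nat_upper_bound (2 * Cmod a)) as [K [K0 hK]].
  exists K; intros N hN; split; [apply norm_ge_0|].
  assert (hN' : (INR K <= INR (S N))%R) by (apply le_INR; lia).
  eapply Rle_trans; [apply (norm_sum_n_m (V := C_NormedModule))|].
  eapply Rle_trans.
  { apply (sum_n_m_le _ (fun _ => 4 / INR (S N) ^ 2)%R).
    intros n; change norm with Cmod; apply Cmod_wz_le; [exact ha | lia | lra]. }
  rewrite sum_n_m_const, Nat.sub_0_r.
  apply Req_le; field; apply not_0_INR; lia.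
- apply is_lim_seq_const.
- replace (Finite 0) with (Rbar_mult 4 0) by (simpl; f_equal; ring).
  apply is_lim_seq_scal_l.
  apply (is_lim_seq_incr_1 (fun n => / INR n)%R).
  replace (Finite 0) with (Rbar_inv p_infty) by reflexivity.
  apply is_lim_seq_inv; [apply is_lim_seq_INR | discriminate].
Qed.

(** * Convergence of the left-hand series *)

(** A telescoping comparison series, with partial sums [1 - 1/(N+2)]. *)
Lemma ex_series_inv_mul_succ :
  ex_series (fun k => / ((INR k + 1) * (INR k + 2)))%R.
Proof.
exists 1%R.
change (is_lim_seq
  (sum_n (fun k => / ((INR k + 1) * (INR k + 2)))%R) 1).
apply (is_lim_seq_ext (fun N => 1 - / INR (S (S N)))%R).
- intros N; induction N as [|N IH].
  + rewrite sum_O; simpl; field.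
  + rewrite sum_Sn, <- IH; change plus with Rplus.
    pose proof (pos_INR N).
    rewrite !S_INR; field; lra.
- replace (Finite 1) with (Finite (1 - 0)) by (f_equal; ring).
  apply is_lim_seq_minus'; [apply is_lim_seq_const|].
  apply (is_lim_seq_incr_1 (fun n => / INR (S n))%R).
  apply (is_lim_seq_incr_1 (fun n => / INR n)%R).
  replace (Finite 0) with (Rbar_inv p_infty) by reflexivity.
  apply is_lim_seq_inv; [apply is_lim_seq_INR | discriminate].
Qed.

Lemma zeta_series_converges (a : C) (ha : not_nonzero_integer a) :
  exists s : C, is_series
    (fun k : nat => 1 / (INR (k + 1) * (INR (k + 1) ^ 2 - a ^ 2))) s.
Proof.
destruct (nat_upper_bound (2 * Cmod a)) as [K [_ hK]].
apply (ex_series_incr_n (V := C_NormedModule) _ K).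
apply (ex_series_le (V := C_CompleteNormedModule) _
  (fun k => 4 * / ((INR (K + k) + 1) * (INR (K + k) + 2)))%R).
- intros k; change norm with Cmod.
  replace (K + k + 1)%nat with (S (K + k)) by lia.
  pose proof (square_sub_neq0 a ha (K + k)) as h.
  pose proof (Cmod_square_sub_ge a (INR (K + k) + 1)) as hd.
  rewrite RtoC_plus in hd.
  rewrite RtoC_INR_S.
  pose proof (pos_INR K); pose proof (pos_INR k).
  set (x := INR (K + k)) in *.
  assert (hx : (INR K <= x)%R) by (unfold x; rewrite plus_INR; lra).
  assert (hx0 : RtoC x + 1 <> 0)
    by real_neq0.
  rewrite Cmod_div, Cmod_1, Cmod_mult by (now apply Cmult_neq_0).
  rewrite <- RtoC_plus, Cmod_R, Rabs_pos_eq by lra.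
  rewrite RtoC_plus.
  unfold Rdiv; rewrite Rmult_1_l.
  (* With [x + 1] common to both denominators, it remains to use [(x+1)^2 / 2 >= (x+2) / 4]. *)
  replace (4 * / ((x + 1) * (x + 2)))%R with (/ ((x + 1) * ((x + 2) / 4)))%R
    by (field; lra).
  apply Rinv_le_contravar; [nra|].
  apply Rmult_le_compat_l; [lra|].
  eapply Rle_trans; [|apply hd; lra]; nra.
- apply (ex_series_scal_l (V := R_NormedModule) 4%R).
  apply (ex_series_incr_n (V := R_NormedModule)
    (fun k => / ((INR k + 1) * (INR k + 2)))%R K), ex_series_inv_mul_succ.
Qed.

(** * Matching the two paths with the two series *)

Lemma wz_0_l (a : C) (ha : not_nonzero_integer a) (k : nat) :
  wz a 0 k = 2 * (1 / (INR (k + 1) * (INR (k + 1) ^ 2 - a ^ 2))).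
Proof.
unfold wz; simpl Nat.add; rewrite poch_pair_S.
pose proof (square_sub_neq0 a ha k) as h.
pose proof (pos_INR k).
pose proof (poch_pair_neq0 a ha k).
rewrite Nat.add_1_r, RtoC_INR_S.
unfold poch_pair at 1; simpl pochhammer; simpl INR.
field; repeat split; try assumption; real_neq0.
Qed.

(** The two steps of one stair share the factor [P n ^ 2 / P (2n+2)]; adding their cofactors
    produces the polynomial with [30 n + 19] and [12 n + 7]. *)
Lemma wz_diagonal (a : C) (ha : not_nonzero_integer a) (n : nat) :
  (pochhammer (1 + a) n ^ 2 * pochhammer (1 - a) n ^ 2 *
    (INR (n + 1) ^ 2 * (30 * INR n + 19) - a ^ 2 * (12 * INR n + 7))) /
  (pochhammer (1 + a) (2 * n + 2) * pochhammer (1 - a) (2 * n + 2) *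
    INR (n + 1) * (2 * INR n + 1)) =
  2 * (wz a n n + wz a (S n) n).
Proof.
fold (poch_pair a (2 * n + 2)).
replace (pochhammer (1 + a) n ^ 2 * pochhammer (1 - a) n ^ 2)
  with (poch_pair a n ^ 2) by (unfold poch_pair; ring).
unfold wz.
replace (2 * n + 2)%nat with (S (S (n + n))) by lia.
replace (S n + n)%nat with (S (n + n)) by lia.
rewrite (poch_pair_S a n), (poch_pair_S a (S (n + n))).
pose proof (square_sub_neq0 a ha (S (n + n))) as h.
pose proof (poch_pair_neq0 a ha (S (n + n))) as hP.
revert h; rewrite Nat.add_1_r, !RtoC_INR_S, RtoC_INR_add; intros h.
pose proof (pos_INR n).
field_simplify_eq; [ring|].
repeat split; try assumption; real_neq0.
Qed.

Theorem theorem3 (a : C) (ha : forall z : Z, z <> 0%Z -> a <> RtoC (IZR z)) :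
  exists s t : C,
    is_series (fun k : nat => 1 / (INR (k + 1) * (INR (k + 1) ^ 2 - a ^ 2))) s /\
    is_series (fun n : nat =>
      (pochhammer (1 + a) n ^ 2 * pochhammer (1 - a) n ^ 2 *
        (INR (n + 1) ^ 2 * (30 * INR n + 19) - a ^ 2 * (12 * INR n + 7))) /
      (pochhammer (1 + a) (2 * n + 2) * pochhammer (1 - a) (2 * n + 2) *
        INR (n + 1) * (2 * INR n + 1))) t /\
    s = 1 / 4 * t.
Proof.
destruct (zeta_series_converges a ha) as [s hs].
(* The inner 2 comes from [wz_0_l], the outer 2 from [wz_diagonal]. *)
exists s, (2 * (2 * s)); split; [exact hs | split; [|field; real_neq0]].
apply (is_series_ext (V := C_NormedModule) (fun n => 2 * (wz a n n + wz a (S n) n))).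
{ intros n; symmetry; now apply wz_diagonal. }
apply (is_series_scal (V := C_NormedModule) (RtoC 2)).
assert (h0 : is_series (V := C_NormedModule) (wz a 0) (2 * s)).
{ eapply is_series_ext; [|apply (is_series_scal (V := C_NormedModule) (RtoC 2) _ _ hs)].
  intros k; symmetry; now apply wz_0_l. }
unfold is_series.
(* The summand 0 is the limit of the boundary sum along the second side of the square. *)
replace (2 * s) with (2 * s + 0) by ring.
apply (filterlim_ext (fun N => sum_n (wz a 0) N + sum_n (wz a (S N)) N)).
{ intros N; now apply wz_sum. }
eapply filterlim_comp_2; [exact h0 | now apply wz_boundary_to_0 |].
apply (filterlim_plus (V := C_NormedModule) (2 * s) (RtoC 0)).
Qed.
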